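(* Let $\mathcal{Q}\subseteq\Delta\mathcal{K}$ be a nonempty convex set and $\alpha\in[0,1)$. Then the distributionally robust network interdiction (DRNI) problem $$\min_{u\in\Delta\mathcal{L}}\ \max_{q\in\mathcal{Q}}\ \mathrm{CVaR}^{\alpha}_{\ell\sim u,\,k\sim q}[f_{\ell,k}]$$ is equivalent to the following problem in the variables $u\in\mathbb{R}^{\mathcal{L}}$, $\zeta\in\mathbb{R}$, $\Delta\in\mathbb{R}^{\mathcal{L}\times\mathcal{K}}$, $t\in\mathbb{R}$, $\eta\in\mathbb{R}^{\mathcal{L}}$: $$\begin{aligned} \min_{u,\zeta,\Delta,t,\eta}\quad & t\\ \text{subject to}\quad & \zeta+\frac{1}{1-\alpha}\sum_{\ell\in\mathcal{L}}\sum_{k\in\mathcal{K}}q_k\Delta_{\ell,k}\le t &&\forall q\in\mathcal{Q},\\ &\Delta_{\ell,k}\ge u_\ell f_{\ell,k}-\eta_\ell &&\forall \ell\in\mathcal{L},\ k\in\mathcal{K},\\ &\eta_\ell=u_\ell\zeta &&\forall \ell\in\mathcal{L},\\ &\Delta_{\ell,k}\ge 0 &&\forall \ell\in\mathcal{L},\ k\in\mathcal{K},\\ &u\ge 0,\quad \sum_{\ell\in\mathcal{L}}u_\ell=1,\quad 0\le\zeta\le\bar\zeta, \end{aligned}$$ where $\bar\zeta:=\max_{k\in\mathcal{K}}f_{0,k}$. Here equivalent means that the two problems have the same optimal value and that $u$ is optimal for the DRNI problem if and only if it can be completed to an optimal solution $(u,\zeta,\Delta,t,\eta)$ of the second problem.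 Moreover the second problem is bi-convex, in the sense that for each fixed $\zeta$ it is a convex problem in the remaining variables, and for each fixed $u$ it is a convex problem in the remaining variables.
   Context: Let $G=(V,E)$ be a finite directed graph with distinct source $s$ and sink $t$ in $V$ (the node $t$ is unrelated to the scalar variable $t$ in the optimization problem). Let $\mathcal{K}$ be a finite nonempty set of scenarios, and for each $k\in\mathcal{K}$ let $c^k\in\mathbb{R}_+^{E}$ be a vector of arc capacities. For an integer $B\ge 0$, the set of interdiction plans is $\mathcal{L}=\{\ell\in\{0,1\}^{E}:\sum_{e\in E}\ell_e\le B\}$; $0\in\mathcal{L}$ denotes the plan with no interdiction. For $\ell\in\mathcal{L}$ and $k\in\mathcal{K}$, $f_{\ell,k}$ is the maximum flow into $t$ after interdiction: $$f_{\ell,k}:=\max\Big\{\sum_{e\text{ entering }t}x_e \;:\; \sum_{e\text{ leaving }i}x_e-\sum_{e\text{ entering }i}x_e=0\ \ \forall i\in V\setminus\{s,t\},\ \ 0\le x_e\le c^k_e(1-\ell_e)\ \ \forall e\in E\Big\}.$$ For a finite set $\mathcal{X}$, $\Delta\mathcal{X}\subseteq\mathbb{R}_+^{\mathcal{X}}$ denotes the set of probability distributions on $\mathcal{X}$. For $u\in\Delta\mathcal{L}$ and $q\in\Delta\mathcal{K}$, $$\mathrm{CVaR}^{\alpha}_{\ell\sim u,\,k\sim q}[f_{\ell,k}]:=\inf_{\zeta\in\mathbb{R}}\ \zeta+\frac{1}{1-\alpha}\sum_{\ell\in\mathcal{L}}\sum_{k\in\mathcal{K}}q_k u_\ell\,[f_{\ell,k}-\zeta]^+,\qquad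 [a]^+:=\max(a,0).$$ The maximum over $q\in\mathcal{Q}$ is understood as a supremum if it is not attained. *)

(* Defs.v *)
(* MathComp / MathComp-Analysis *)
From mathcomp Require Import all_boot all_order all_algebra.
From mathcomp Require Import all_classical all_reals all_analysis.

Set Implicit Arguments.
Unset Strict Implicit.
Unset Printing Implicit Defensive.

Import Order.TTheory GRing.Theory Num.Theory.

Local Open Scope classical_set_scope.
Local Open Scope ring_scope.

(** Minimization of [f] over [D].  The value is taken in [\bar R], so that it is
    always defined ([+oo] if [D] is empty, [-oo] if [f] is unbounded below). *)
Definition optimal_value (R : realType) (X : Type) (D : set X)
  (f : X -> \bar R) : \bar R := ereal_inf [set f x | x in D].

Definition optimal_solution (R : realType) (X : Type) (D : set X)
  (f : X -> \bar R) (x : X) : Prop :=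
  D x /\ forall y, D y -> (f x <= f y)%E.

Definition convex_problem (R : realType) (X : lmodType R) (D : set X)
  (f : X -> R) : Prop :=
  convex_set (D : set (convex_lmodType X)) /\
  convex_function (D : set (convex_lmodType X)) (f : X -> R^o).

(** Real vectors are finite functions into [R^o]: the alias [R^o] makes
    [{ffun X -> R^o}] a vector space over [R]. *)
Definition distributions (R : realType) (X : finType) : set {ffun X -> R^o} :=
  [set p | (forall x, 0 <= p x) /\ \sum_(x : X) p x = 1].
Arguments distributions : clear implicits.

(** The digraph is given by the endpoints [tail e], [head e] of each arc [e]. *)
Definition flow (R : realType) (V E : finType) (tail head : E -> V) (s t : V)
  (cap : E -> R) (x : E -> R) : Prop :=
  (forall i : V, i != s -> i != t ->
     \sum_(e : E | tail e == i) x e - \sum_(e : E | head e == i) x e = 0) /\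
  (forall e : E, 0 <= x e <= cap e).

(** For [cap >= 0] the set below is nonempty and compact, so that its supremum
    is a maximum. *)
Definition max_flow (R : realType) (V E : finType) (tail head : E -> V)
  (s t : V) (cap : E -> R) : R :=
  sup [set \sum_(e : E | head e == t) x e | x in flow tail head s t cap].

(** [l e = true] means that the arc [e] is interdicted. *)
Definition plan (E : finType) (B : nat) : finType :=
  {l : {ffun E -> bool} | (\sum_(e : E) l e <= B)%N}.

Lemma plan0_subproof (E : finType) (B : nat) :
  (\sum_(e : E) [ffun _ : E => false] e <= B)%N.
Proof. by rewrite big1 // => e _; rewrite ffunE. Qed.

Definition plan0 (E : finType) (B : nat) : plan E B :=
  exist (fun l : {ffun E -> bool} => \sum_(e : E) l e <= B)%N
    [ffun=> false] (plan0_subproof E B).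

Definition interdicted_flow (R : realType) (V E K : finType)
  (tail head : E -> V) (s t : V) (c : K -> E -> R) (B : nat)
  (l : plan E B) (k : K) : R :=
  max_flow tail head s t (fun e => c k e * (1 - (val l e)%:R)).

Definition CVaR (R : realType) (L K : finType) (alpha : R) (f : L -> K -> R)
  (u : {ffun L -> R^o}) (q : {ffun K -> R^o}) : \bar R :=
  ereal_inf (range (fun zeta : R =>
    (zeta + (1 - alpha)^-1 *
       \sum_(l : L) \sum_(k : K) q k * u l * Num.max (f l k - zeta) 0)%:E)).

Definition DRNI_objective (R : realType) (L K : finType)
  (Q : set {ffun K -> R^o}) (alpha : R) (f : L -> K -> R)
  (u : {ffun L -> R^o}) : \bar R :=
  ereal_sup [set CVaR alpha f u q | q in Q].

Definition reformulation_constraints (R : realType) (L K : finType)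
  (Q : set {ffun K -> R^o}) (alpha : R) (f : L -> K -> R) (zetabar : R)
  (u : {ffun L -> R^o}) (zeta : R) (Delta : {ffun L * K -> R^o}) (t : R)
  (eta : {ffun L -> R^o}) : Prop :=
  [/\ forall q, Q q ->
        zeta + (1 - alpha)^-1 *
          \sum_(l : L) \sum_(k : K) q k * Delta (l, k) <= t,
      forall l k, u l * f l k - eta l <= Delta (l, k),
      forall l, eta l = u l * zeta,
      forall l k, 0 <= Delta (l, k) &
      [/\ forall l, 0 <= u l, \sum_(l : L) u l = 1 & 0 <= zeta <= zetabar]].

(** The variables are ordered as [(u, zeta, Delta, t, eta)]. *)
Definition reformulation_vars (R : realType) (L K : finType) : Type :=
  ({ffun L -> R^o} * R^o * {ffun L * K -> R^o} * R^o * {ffun L -> R^o})%type.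

Definition reformulation_feasible (R : realType) (L K : finType)
  (Q : set {ffun K -> R^o}) (alpha : R) (f : L -> K -> R) (zetabar : R) :
  set (reformulation_vars R L K) :=
  [set w | let: (u, zeta, Delta, t, eta) := w in
    reformulation_constraints Q alpha f zetabar u zeta Delta t eta].

Definition reformulation_objective (R : realType) (L K : finType)
  (w : reformulation_vars R L K) : \bar R :=
  let: (u, zeta, Delta, t, eta) := w in t%:E.

Definition biconvex_reformulation (R : realType) (L K : finType)
  (Q : set {ffun K -> R^o}) (alpha : R) (f : L -> K -> R) (zetabar : R) :
  Prop :=
  (forall zeta : R,
     convex_problem
       [set w : {ffun L -> R^o} * {ffun L * K -> R^o} * R^o * {ffun L -> R^o} |
          let: (u, Delta, t, eta) := w in
          reformulation_constraints Q alpha f zetabar u zeta Delta t eta]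
       (fun w => let: (u, Delta, t, eta) := w in t)) /\
  (forall u : {ffun L -> R^o},
     convex_problem
       [set w : R^o * {ffun L * K -> R^o} * R^o * {ffun L -> R^o} |
          let: (zeta, Delta, t, eta) := w in
          reformulation_constraints Q alpha f zetabar u zeta Delta t eta]
       (fun w => let: (zeta, Delta, t, eta) := w in t)).

(* Main.v *)
(* For a fixed plan distribution [u], the CVaR integrand is convex and continuous
   in [zeta] and affine in [q], and its minimum over [zeta] is attained in
   [[0, zetabar]].  As [Q] is convex but not compact, [sup_q] and [min_zeta] are
   exchanged using compactness of the interval: the sublevel sets in [zeta] at
   the level [sup_q min_zeta] are compact intervals, which meet pairwise by a
   two-function convex alternative, so they have a common point by Helly's
   theorem on the line.  This common [zeta], with
   [Delta (l, k) = u l * max (f l k - zeta) 0] and [eta l = u l * zeta],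
   completes [u] to a feasible point whose [t] is the DRNI objective of [u];
   conversely the [t] of any feasible point bounds that objective from above. *)
Require Import Defs.
From mathcomp Require Import all_boot all_order all_algebra.
From mathcomp Require Import all_classical all_reals all_analysis.
From mathcomp Require Import ring lra.

Set Implicit Arguments.
Unset Strict Implicit.
Unset Printing Implicit Defensive.

Import Order.TTheory GRing.Theory Num.Theory.
Import numFieldNormedType.Exports.

Local Open Scope classical_set_scope.
Local Open Scope ring_scope.
Local Open Scope convex_scope.

(** * Convex combinations and the two-function convex alternative *)

Lemma conv_lmodE (R : numDomainType) (E : lmodType R) (p : {i01 R})
    (x y : convex_lmodType E) :
  x <| p |> y = p%:num *: (x : E) + (1 - p%:num) *: (y : E).
Proof. by []. Qed.

Lemma conv_regE (R : numDomainType) (p : {i01 R})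
    (x y : convex_lmodType R^o) :
  x <| p |> y = p%:num * (x : R) + (1 - p%:num) * (y : R).
Proof. by []. Qed.

Lemma conv_numE (R : numDomainType) (p : {i01 R}) (x y : R^o) :
  x <| p |> y = p%:num * (x : R) + (1 - p%:num) * (y : R).
Proof. by []. Qed.

(* The weight [p] is the least one that works where [h2 < 0]; by convexity it
   does not exceed any of the bounds required where [h1 < 0]. *)
Lemma convex_alternative (R : realType) (E : lmodType R)
    (D : set (convex_lmodType E)) (h1 h2 : convex_lmodType E -> R^o) :
  convex_set D -> convex_function D h1 -> convex_function D h2 ->
  (forall z, D z -> 0 <= h1 z \/ 0 <= h2 z) ->
  exists p : {i01 R}, forall z, D z -> 0 <= p%:num * h1 z + (1 - p%:num) * h2 z.
Proof.
move=> cD c1 c2 h12.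
(* With denominators cleared: the lower bound on the weight imposed at [z], where [h2 z < 0], is at
   most the upper bound imposed at [z'], where [h1 z' < 0]. *)
have cross z z' : D z -> D z' -> h2 z < 0 -> h1 z' < 0 ->
    h2 z * h1 z' <= h2 z' * h1 z.
  move=> Dz Dz' z0 z'0; rewrite leNgt; apply/negP => lt0.
  have h1z : 0 <= h1 z by case: (h12 _ Dz) => //; rewrite leNgt z0.
  have h2z : 0 <= h2 z' by case: (h12 _ Dz') => //; rewrite leNgt z'0.
  (* With the weights [a], [b] both functions would take the value
     [h1 z * h2 z' - h2 z * h1 z' < 0], up to normalization. *)
  pose a : R := h2 z' - h1 z'; pose b : R := h1 z - h2 z.
  have ab0 : 0 < a + b by rewrite /a /b; lra.
  have ab1 : 0 <= a / (a + b) by apply: divr_ge0; rewrite /a /b; lra.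
  have ab2 : a / (a + b) <= 1 by rewrite ler_pdivrMr // /a /b; lra.
  pose m := Itv01 ab1 ab2.
  have Dm : D (z <| m |> z') by apply: set_mem; apply: cD; exact: mem_set.
  have Ea (x y : R) : a / (a + b) * x + (1 - a / (a + b)) * y =
      (a * x + b * y) / (a + b).
    by field; rewrite gt_eqF.
  have neg (x : R) : x < 0 -> x / (a + b) < 0 by move=> ?; rewrite ltr_pdivrMr ?mul0r.
  case: (h12 _ Dm); apply/negP; rewrite -ltNge.
    apply: le_lt_trans (c1 m z z' (mem_set Dz) (mem_set Dz')) _.
    rewrite conv_numE /= Ea; apply: neg.
    by rewrite /a /b; lra.
  apply: le_lt_trans (c2 m z z' (mem_set Dz) (mem_set Dz')) _.
  rewrite conv_numE /= Ea; apply: neg.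
  by rewrite /a /b; lra.
(* Besides 0, which makes the supremum nonnegative, [S] holds the weights at which the combination
   vanishes at a point with [h2 z < 0]. *)
pose S := [set 0 : R] `|` [set - h2 z / (h1 z - h2 z) | z in D `&` [set z | h2 z < 0]].
have S0 : S !=set0 by exists 0; left.
have S1 : ubound S 1.
  move=> _ [->|[z [Dz /= z0] <-]] //.
  have h1z : 0 <= h1 z by case: (h12 _ Dz) => //; rewrite leNgt z0.
  by rewrite ler_pdivrMr; lra.
have hS : has_ubound S by exists 1.
have p0 : 0 <= sup S by apply: ub_le_sup => //; left.
have p1 : sup S <= 1 by apply: ge_sup.
exists (Itv01 p0 p1) => z Dz /=.
have [h2z|h2z] := leP 0 (h2 z).
  have [h1z|h1z] := leP 0 (h1 z).
    by apply: addr_ge0; apply: mulr_ge0 => //; rewrite subr_ge0.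
  (* Here [h1 z < 0 <= h2 z], so the weight must stay below [h2 z / (h2 z - h1 z)]; [cross] gives
     this for each member of [S]. *)
  suff : sup S * (h2 z - h1 z) <= h2 z by lra.
  rewrite -ler_pdivlMr ?subr_gt0 //; last by lra.
  apply: ge_sup => // _ [->|[y [Dy /= y0] <-]].
    by apply: divr_ge0 => //; lra.
  have h1y : 0 <= h1 y by case: (h12 _ Dy) => //; rewrite leNgt y0.
  rewrite ler_pdivrMr; last by lra.
  rewrite mulrAC ler_pdivlMr; last by lra.
  have := cross _ _ Dy Dz y0 h1z; lra.
have h1z : 0 <= h1 z by case: (h12 _ Dz) => //; rewrite leNgt h2z.
have : - h2 z / (h1 z - h2 z) <= sup S by apply: ub_le_sup => //; right; exists z.
by rewrite ler_pdivrMr; lra.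
Qed.

(** * Minimax exchange over a compact interval *)

(** For [v] equal to the supremum over [q] of the minima over [z], this is the nontrivial inequality
    of the minimax exchange. *)
Lemma minimax_interval (R : realType) (T : lmodType R)
    (Q : set (convex_lmodType T)) (a b v : R) (g : R -> convex_lmodType T -> R) :
  a <= b -> convex_set Q ->
  (forall q, Q q -> continuous (g ^~ q)) ->
  (forall q, Q q ->
     convex_function (`[a, b]%classic : set (convex_lmodType R^o)) (g ^~ q)) ->
  (forall (p : {i01 R}) z q q', Q q -> Q q' ->
     p%:num * g z q + (1 - p%:num) * g z q' <= g z (q <| p |> q')) ->
  (forall q, Q q -> exists2 z, a <= z <= b & g z q <= v) ->
  exists2 z, a <= z <= b & forall q, Q q -> g z q <= v.
Proof.
move=> ab cQ gcont gconv gconc gv.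
have cab : convex_set (`[a, b]%classic : set (convex_lmodType R^o)).
  move=> x y p /set_mem /=; rewrite in_itv /= => /andP[ax xb].
  move=> /set_mem /=; rewrite in_itv /= => /andP[ay yb].
  apply: mem_set => /=; rewrite in_itv /= conv_regE.
  have p0 : 0 <= p%:num by exact: ge0.
  have p1 : 0 <= 1 - p%:num by rewrite subr_ge0; exact: le1.
  have -> : a = p%:num * a + (1 - p%:num) * a by ring.
  have -> : b = p%:num * b + (1 - p%:num) * b by ring.
  by apply/andP; split; apply: lerD; apply: ler_wpM2l.
(* Otherwise the minimum over the interval of the larger of the two functions exceeds [v]. The
   alternative then yields a mixture of [q] and [q'] at which [g] stays above [v] on the whole
   interval, against [gv]. *)
have pairwise q q' : Q q -> Q q' ->
    exists2 z, a <= z <= b & g z q <= v /\ g z q' <= v.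
  move=> Qq Qq'; apply: contrapT => no.
  pose M z := Num.max (g z q) (g z q').
  have Mcont : {within `[a, b], continuous M}.
    apply: continuous_subspaceT => x.
    by apply: (@continuous_max _ _ (g ^~ q) (g ^~ q')); apply: gcont.
  have [z zab Mmin] := EVT_min ab Mcont.
  have Mv : v < M z.
    rewrite ltNge ge_max; apply/negP => /andP[m1 m2].
    by apply: no; exists z => //; move: zab; rewrite in_itv.
  have shift q0 : Q q0 -> convex_function
      (`[a, b]%classic : set (convex_lmodType R^o)) (fun y => g y q0 - M z).
    move=> Qq0 p x y xab yab; have := gconv _ Qq0 p x y xab yab.
    by rewrite !conv_numE; lra.
  have [|p Hp] := convex_alternative cab (shift _ Qq) (shift _ Qq').
    move=> y yab; have := Mmin y yab; rewrite {2}/M le_max => /orP[] ?.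
      by left; rewrite subr_ge0.
    by right; rewrite subr_ge0.
  have Qp : Q (q <| p |> q') by apply: set_mem; apply: cQ; exact: mem_set.
  have [y yab gy] := gv _ Qp.
  have {}Hp := Hp y; have := gconc p y _ _ Qq Qq'.
  have : `[a, b]%classic y by rewrite /= in_itv.
  move=> /Hp; lra.
(* The supremum of the left endpoints of the intervals [g ^~ q <= v] is a common
   point, as these intervals meet pairwise (Helly in dimension one). *)
pose A := [set x | a <= x <= b /\
  exists2 q, Q q & forall y, a <= y <= b -> g y q <= v -> x <= y].
have [[q1 Qq1]|Q0] := pselect (exists q, Q q); last first.
  by exists a; [rewrite lexx | move=> q Qq; case: Q0; exists q].
have Aa : A a by split; [rewrite lexx | exists q1 => // y /andP[]].
have A0 : A !=set0 by exists a.
have Ab : ubound A b by move=> x [/andP[]].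
have hA : has_ubound A by exists b.
have aA : a <= sup A by apply: ub_le_sup.
have Ab' : sup A <= b by apply: ge_sup.
exists (sup A) => [|q Qq]; first by rewrite aA.
rewrite leNgt; apply/negP => lt.
have : \forall z \near sup A, v < g z q.
  exact: (gcont _ Qq (sup A)) _ (lt_nbhsr lt).
rewrite -nbhs_nearE => /nbhs_ballP [e /= e0 he].
have [y /andP[ay yb] gy] := gv _ Qq.
(* By convexity the sublevel set of [g ^~ q] lies on one side of [sup A]. *)
have side x y' : a <= x <= b -> a <= y' <= b -> g x q <= v -> g y' q <= v ->
    x < sup A -> sup A < y' -> False.
  move=> xab yab gx gy' xs sy.
  have d0 : 0 < y' - x by lra.
  have p0 : 0 <= (y' - sup A) / (y' - x) by apply: divr_ge0; lra.
  have p1 : (y' - sup A) / (y' - x) <= 1 by rewrite ler_pdivrMr //; lra.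
  have := @gconv _ Qq (Itv01 p0 p1) x y'.
  rewrite conv_regE conv_numE /= !inE /= !in_itv /= => /(_ xab yab).
  have -> : (y' - sup A) / (y' - x) * x + (1 - (y' - sup A) / (y' - x)) * y'
     = sup A by field; rewrite gt_eqF.
  move: p0 p1; set l := _ / _ => p0 p1; nra.
have away x : g x q <= v -> x <= sup A - e \/ sup A + e <= x.
  move=> gx; have [?|?] := leP x (sup A - e); first by left.
  have [?|?] := leP (sup A + e) x; first by right.
  have : ball (sup A) e x by rewrite /ball /= ltr_norml; lra.
  by move=> /he /=; rewrite ltNge gx.
(* If the sublevel set of [q] has a point left of [sup A], it lies entirely there by [side], so at
   distance at least [e]; it then misses the sublevel set of some [q'] that starts beyond
   [sup A - e]. If it lies on the right, [sup A + e] belongs to [A]. *)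
have [ys|ys] := away _ gy.
  have [x [xab [q' Qq' hx]] xe] : exists2 x, A x & sup A - e < x.
    by apply: sup_adherent.
  have [w wab [gw1 gw2]] := pairwise _ _ Qq Qq'.
  have xw := hx _ wab gw2.
  have [ws|ws] := away _ gw1; first by lra.
  by apply: (@side y w) => //; [rewrite ay | lra | lra].
suff : A (sup A + e) by move=> /(ub_le_sup hA); lra.
split; first by lra.
exists q => // w wab gw; have [ws|//] := away _ gw.
exfalso; by apply: (@side w y) => //; [rewrite ay | lra | lra].
Qed.

(** * Bounds on maximum flows *)

(** The zero flow is feasible, and the capacities entering [t] bound all flow values, so [sup] is a
    genuine upper bound. *)
Lemma max_flow_ge0 (R : realType) (V E : finType) (tail head : E -> V)
    (s t : V) (cap : E -> R) :
  (forall e, 0 <= cap e) -> 0 <= max_flow tail head s t cap.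
Proof.
move=> cap0; apply: ub_le_sup.
  exists (\sum_(e : E | head e == t) cap e) => _ [x [_ xc] <-].
  by apply: ler_sum => e _; case/andP: (xc e).
exists (fun=> 0); last by rewrite big1.
by split=> [i _ _|e]; rewrite ?big1 ?subrr // lexx cap0.
Qed.

Lemma le_max_flow (R : realType) (V E : finType) (tail head : E -> V)
    (s t : V) (cap cap' : E -> R) :
  (forall e, 0 <= cap e) -> (forall e, cap e <= cap' e) ->
  max_flow tail head s t cap <= max_flow tail head s t cap'.
Proof.
move=> cap0 capcap'; apply: ge_sup.
  exists 0, (fun=> 0); last by rewrite big1.
  by split=> [i _ _|e]; rewrite ?big1 ?subrr // lexx cap0.
move=> _ [x [xc xcap] <-]; apply: ub_le_sup.
  exists (\sum_(e : E | head e == t) cap' e) => _ [y [_ yc] <-].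
  by apply: ler_sum => e _; case/andP: (yc e).
exists x => //; split=> // e; have /andP[-> xe] := xcap e.
exact: le_trans (capcap' e).
Qed.

Lemma interdicted_flow_ge0 (R : realType) (V E K : finType)
    (tail head : E -> V) (s t : V) (c : K -> E -> R) (B : nat)
    (l : plan E B) (k : K) :
  (forall k e, 0 <= c k e) -> 0 <= interdicted_flow tail head s t c l k.
Proof.
move=> c0; apply: max_flow_ge0 => e; apply: mulr_ge0 => //.
by rewrite subr_ge0 lern1; case: (val l e).
Qed.

(** Interdiction only lowers capacities; hence [zetabar], built from the empty plan alone, bounds
    the flow under every plan. *)
Lemma interdicted_flow_le_plan0 (R : realType) (V E K : finType)
    (tail head : E -> V) (s t : V) (c : K -> E -> R) (B : nat)
    (l : plan E B) (k : K) :
  (forall k e, 0 <= c k e) ->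
  interdicted_flow tail head s t c l k <=
  interdicted_flow tail head s t c (plan0 E B) k.
Proof.
move=> c0; apply: le_max_flow => e.
  by apply: mulr_ge0 => //; rewrite subr_ge0 lern1; case: (val l e).
by apply: ler_wpM2l => //; rewrite ffunE subr0 gerBl.
Qed.

(** * Finite suprema and double sums *)

Lemma le_sup_range (R : realType) (K : finType) (h : K -> R) (k : K) :
  h k <= sup (range h).
Proof.
apply: ub_le_sup; last by exists k.
exists (\sum_k `|h k|) => _ [j _ <-]; rewrite (bigD1 j) //=.
by rewrite (le_trans (ler_norm _)) // lerDl sumr_ge0.
Qed.

Lemma sum2_conv (R : comNzRingType) (I J : finType) (p : R) (F G : I -> J -> R) :
  \sum_(i : I) \sum_(j : J) (p * F i j + (1 - p) * G i j) =
  p * (\sum_(i : I) \sum_(j : J) F i j) +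
  (1 - p) * (\sum_(i : I) \sum_(j : J) G i j).
Proof.
rewrite !mulr_sumr -big_split; apply: eq_bigr => i _.
by rewrite !mulr_sumr -big_split.
Qed.

Lemma ler_sum2 (R : numDomainType) (I J : finType) (F G : I -> J -> R) :
  (forall i j, F i j <= G i j) ->
  \sum_(i : I) \sum_(j : J) F i j <= \sum_(i : I) \sum_(j : J) G i j.
Proof. by move=> FG; apply: ler_sum => i _; apply: ler_sum => j _. Qed.

(** * CVaR for an abstract loss [f] with values in [[0, zetabar]] *)

Section CVaR_reformulation.
Variables (R : realType) (L K : finType) (alpha : R) (f : L -> K -> R).
Variable zetabar : R.
Hypothesis alpha01 : 0 <= alpha < 1.
Hypothesis f0 : forall l k, 0 <= f l k.
Hypothesis fzetabar : forall l k, f l k <= zetabar.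

Let kappa := (1 - alpha)^-1.

Let kappa_ge1 : 1 <= kappa.
Proof.
have /andP[a0 a1] := alpha01.
by rewrite /kappa invf_ge1 ?subr_gt0 // gerBl.
Qed.

Definition CVaR_integrand (u : {ffun L -> R^o}) (zeta : R)
    (q : {ffun K -> R^o}) : R :=
  zeta + (1 - alpha)^-1 *
    \sum_(l : L) \sum_(k : K) q k * u l * Num.max (f l k - zeta) 0.

Lemma CVaR_integrand_continuous u q :
  continuous (fun zeta => CVaR_integrand u zeta q).
Proof.
move=> x; apply: cvgD => //; apply: cvgM; first exact: cvg_cst.
have cadd : continuous (fun z : R * R => z.1 + z.2) by exact: add_continuous.
apply: (continuous_big cadd) => l _; apply: (continuous_big cadd) => k _ z.
apply: cvgM; first exact: cvg_cst.
apply: (@continuous_max _ _ (fun y => f l k - y) (fun=> 0)).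
  by apply: cvgB => //; exact: cvg_cst.
exact: cvg_cst.
Qed.

(** Positive parts of affine functions of [zeta] are convex, and their weights are nonnegative. *)
Lemma CVaR_integrand_convex u q (D : set (convex_lmodType R^o)) :
  distributions R L u -> distributions R K q ->
  convex_function D (fun zeta => CVaR_integrand u zeta q).
Proof.
move=> [u0 _] [q0 _] p x y _ _; rewrite conv_regE conv_numE /CVaR_integrand.
have p0 : 0 <= p%:num by exact: ge0.
have p1 : 0 <= 1 - p%:num by rewrite subr_ge0; exact: le1.
rewrite !mulrDr addrACA lerD2l !(mulrCA _ (1 - alpha)^-1) -mulrDr -sum2_conv.
apply: ler_wpM2l; first exact: le_trans kappa_ge1.
apply: ler_sum2 => l k.
rewrite !(mulrCA _ (q k * u l)) -mulrDr ler_wpM2l ?mulr_ge0 //.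
rewrite ge_max addr_ge0 ?mulr_ge0 ?le_max ?lexx ?orbT // andbT.
have -> : f l k - (p%:num * x + (1 - p%:num) * y) =
   p%:num * (f l k - x) + (1 - p%:num) * (f l k - y) by ring.
by rewrite lerD // ler_wpM2l // le_max lexx.
Qed.

Lemma CVaR_integrand_affine u zeta (p : {i01 R})
    (q q' : convex_lmodType {ffun K -> R^o}) :
  CVaR_integrand u zeta (q <| p |> q') =
  p%:num * CVaR_integrand u zeta q + (1 - p%:num) * CVaR_integrand u zeta q'.
Proof.
rewrite conv_lmodE /CVaR_integrand.
pose F (r : {ffun K -> R^o}) : R :=
  \sum_(l : L) \sum_(k : K) r k * u l * Num.max (f l k - zeta) 0.
rewrite -/(F _) -/(F q) -/(F q').
suff -> : F (p%:num *: q + (1 - p%:num) *: q') =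
    p%:num * F q + (1 - p%:num) * F q' by ring.
rewrite -sum2_conv; apply: eq_bigr => l _; apply: eq_bigr => k _.
by rewrite !ffunE /= /GRing.scale /=; ring.
Qed.

Lemma sum_distributions_prod u q :
  distributions R L u -> distributions R K q ->
  \sum_(l : L) \sum_(k : K) q k * u l = 1.
Proof.
move=> [_ u1] [_ q1].
by under eq_bigr do rewrite -mulr_suml q1 mul1r.
Qed.

(** For [zeta < 0] all positive parts are active and the slope in [zeta] is [1 - kappa <= 0], so 0
    does at least as well. Above [zetabar] they all vanish and the integrand is [zeta] itself. *)
Lemma CVaR_integrand_clamp u q zeta :
  0 <= zetabar -> distributions R L u -> distributions R K q ->
  exists2 zeta', 0 <= zeta' <= zetabar &
    CVaR_integrand u zeta' q <= CVaR_integrand u zeta q.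
Proof.
move=> zb0 du dq; have [u0 _] := du; have [q0 _] := dq.
have kappa0 : 0 <= kappa by exact: le_trans kappa_ge1.
have [zeta0|zeta0] := leP 0 zeta; last first.
  exists 0; first by rewrite lexx.
  pose W := \sum_(l : L) \sum_(k : K) q k * u l * Num.max (f l k - 0) 0.
  have W1 : W - zeta <=
      \sum_(l : L) \sum_(k : K) q k * u l * Num.max (f l k - zeta) 0.
    (* The product weights sum to 1, so [zeta] can be spread over the double sum and compared term
       by term. *)
    rewrite -[X in _ - X]mul1r -(sum_distributions_prod du dq) /W.
    rewrite mulr_suml -sumrB; apply: ler_sum => l _.
    rewrite mulr_suml -sumrB; apply: ler_sum => k _.
    rewrite -mulrBr ler_wpM2l ?mulr_ge0 //.
    by rewrite subr0 (max_idPl (f0 l k)) le_max lexx.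
  rewrite /CVaR_integrand -/W -/kappa.
  have := ler_wpM2l kappa0 W1; rewrite mulrBr.
  have : 0 <= (kappa - 1) * (- zeta) by rewrite mulr_ge0 ?subr_ge0 ?oppr_ge0 // ltW.
  by lra.
have [zetab|zetab] := leP zeta zetabar; first by exists zeta; rewrite ?zeta0.
exists zetabar; first by rewrite zb0 lexx.
rewrite /CVaR_integrand; apply: lerD; first exact: ltW.
apply: ler_wpM2l => //; apply: ler_sum2 => l k.
rewrite ler_wpM2l ?mulr_ge0 // ge_max !le_max lexx !orbT andbT.
by rewrite subr_le0 fzetabar orbT.
Qed.

(** The extreme value theorem gives a minimizer on [[0, zetabar]]; clamping makes it global. *)
Lemma CVaR_attained u q :
  0 <= zetabar -> distributions R L u -> distributions R K q ->
  exists2 zeta, 0 <= zeta <= zetabar &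
    CVaR alpha f u q = (CVaR_integrand u zeta q)%:E.
Proof.
move=> zb0 du dq.
have cont := continuous_subspaceT (@CVaR_integrand_continuous u q).
have [zeta zetaI zetamin] := EVT_min zb0 (cont _).
exists zeta; first by move: zetaI; rewrite in_itv.
apply/eqP; rewrite eq_le; apply/andP; split.
  by apply: ereal_inf_lbound; exists zeta.
apply: le_ereal_inf_tmp => _ [z _ <-]; rewrite lee_fin.
have [z' z'I z'z] := CVaR_integrand_clamp z zb0 du dq.
by apply: le_trans z'z; apply: zetamin; rewrite in_itv.
Qed.

(** * Equivalence of the robust problem and its reformulation *)

Variable Q : set {ffun K -> R^o}.
Hypothesis Qdist : Q `<=` distributions R K.
Hypothesis Q0 : Q !=set0.
Hypothesis Qconvex : convex_set (Q : set (convex_lmodType {ffun K -> R^o})).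

Lemma DRNI_objective_attained u :
  0 <= zetabar -> distributions R L u ->
  exists zeta tau : R, [/\ 0 <= zeta <= zetabar,
    DRNI_objective Q alpha f u = tau%:E &
    forall q, Q q -> CVaR_integrand u zeta q <= tau].
Proof.
move=> zb0 du; have [q1 Qq1] := Q0.
(* At [zeta = zetabar] every positive part vanishes. This uniform bound keeps the supremum over [Q]
   finite. *)
have CVaR_le q : Q q -> (CVaR alpha f u q <= zetabar%:E)%E.
  move=> Qq; have [_ q1'] := Qdist Qq.
  apply: ge_ereal_inf; exists (CVaR_integrand u zetabar q)%:E.
    by exists zetabar.
  rewrite lee_fin /CVaR_integrand big1 ?mulr0 ?addr0 // => l _.
  by rewrite big1 // => k _; rewrite (max_idPr _) ?mulr0 // subr_le0.
have fin : DRNI_objective Q alpha f u \is a fin_num.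
  have [z _ Ez] := CVaR_attained zb0 du (Qdist Qq1).
  rewrite fin_numElt; apply/andP; split.
    apply: (@lt_le_trans _ _ (CVaR alpha f u q1)); first by rewrite Ez ltNyr.
    by apply: ereal_sup_ubound; exists q1.
  apply: (@le_lt_trans _ _ zetabar%:E); last by rewrite ltry.
  by apply: ge_ereal_sup => _ [q Qq <-]; exact: CVaR_le.
pose tau := fine (DRNI_objective Q alpha f u).
have Etau : DRNI_objective Q alpha f u = tau%:E by rewrite fineK.
have [|||||q Qq|zeta zetaI Hzeta] :=
    @minimax_interval R {ffun K -> R^o} Q 0 zetabar tau (CVaR_integrand u).
- exact: zb0.
- exact: Qconvex.
- by move=> q _; exact: CVaR_integrand_continuous.
- by move=> q Qq; apply: CVaR_integrand_convex => //; exact: Qdist.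
- by move=> p z q q' _ _; rewrite CVaR_integrand_affine.
- have [z zI Ez] := CVaR_attained zb0 du (Qdist Qq).
  exists z => //; rewrite -lee_fin -Ez -Etau.
  by apply: ereal_sup_ubound; exists q.
by exists zeta, tau.
Qed.

Lemma DRNI_completion u :
  0 <= zetabar -> distributions R L u ->
  exists zeta Delta tau eta,
    reformulation_feasible Q alpha f zetabar (u, zeta, Delta, tau, eta) /\
    DRNI_objective Q alpha f u = tau%:E.
Proof.
move=> zb0 du; have [zeta [tau [zetaI Etau Hzeta]]] :=
  DRNI_objective_attained zb0 du.
have [u0 u1] := du.
exists zeta, [ffun x => u x.1 * Num.max (f x.1 x.2 - zeta) 0], tau,
  [ffun l => u l * zeta]; split => //; split.
- move=> q Qq; apply: le_trans (Hzeta q Qq); rewrite le_eqVlt; apply/orP; left.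
  apply/eqP; congr (_ + _ * _); apply: eq_bigr => l _; apply: eq_bigr => k _.
  by rewrite ffunE /= mulrA.
- move=> l k; rewrite !ffunE /= -mulrBr ler_wpM2l //.
  by rewrite le_max lexx.
- by move=> l; rewrite ffunE.
- by move=> l k; rewrite ffunE /= mulr_ge0 // le_max lexx orbT.
- by [].
Qed.

(** With [eta l = u l * zeta] and [u l >= 0], the two lower bounds on [Delta] combine into
    [u l * max (f l k - zeta) 0], so [tau] dominates the integrand at [zeta] for every [q]. *)
Lemma DRNI_objective_le_feasible u zeta Delta tau eta :
  reformulation_feasible Q alpha f zetabar (u, zeta, Delta, tau, eta) ->
  distributions R L u /\ (DRNI_objective Q alpha f u <= tau%:E)%E.
Proof.
move=> [Htau HDelta Heta Delta0 [u0 u1 zetaI]]; split => //.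
apply: ge_ereal_sup => _ [q Qq <-]; have [q0 _] := Qdist Qq.
apply: ge_ereal_inf; exists (CVaR_integrand u zeta q)%:E; first by exists zeta.
rewrite lee_fin; apply: le_trans (Htau q Qq); rewrite lerD2l.
apply: ler_wpM2l; first exact: le_trans kappa_ge1.
apply: ler_sum2 => l k; rewrite -mulrA ler_wpM2l //.
rewrite maxr_pMr // mulr0 ge_max Delta0 andbT mulrBr -Heta.
exact: HDelta.
Qed.

(** Projecting a feasible point to [u] does not raise the objective, and completing [u] preserves
    it. *)
Lemma DRNI_optimal_value :
  0 <= zetabar ->
  optimal_value (distributions R L) (DRNI_objective Q alpha f) =
  optimal_value (reformulation_feasible Q alpha f zetabar)
    (@reformulation_objective R L K).
Proof.
move=> zb0; apply/eqP; rewrite eq_le; apply/andP; split.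
  apply: le_ereal_inf_tmp => _ [[[[[u zeta] Delta] tau] eta] wF <-].
  have [du le_tau] := DRNI_objective_le_feasible wF.
  by apply: ge_ereal_inf; exists (DRNI_objective Q alpha f u) => //; exists u.
apply: le_ereal_inf_tmp => _ [u du <-].
have [zeta [Delta [tau [eta [wF ->]]]]] := DRNI_completion zb0 du.
by apply: ereal_inf_lbound; exists (u, zeta, Delta, tau, eta).
Qed.

Lemma DRNI_optimal_solution u :
  0 <= zetabar ->
  optimal_solution (distributions R L) (DRNI_objective Q alpha f) u <->
  exists zeta Delta tau eta,
    optimal_solution (reformulation_feasible Q alpha f zetabar)
      (@reformulation_objective R L K) (u, zeta, Delta, tau, eta).
Proof.
move=> zb0; split.
  move=> [du umin].
  have [zeta [Delta [tau [eta [wF Etau]]]]] := DRNI_completion zb0 du.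
  exists zeta, Delta, tau, eta; split => // -[[[[u' z'] D'] t'] e'] wF'.
  have [du' le_tau'] := DRNI_objective_le_feasible wF'.
  by rewrite /= -Etau (le_trans (umin _ du')).
move=> [zeta [Delta [tau [eta [wF wmin]]]]].
have [du le_tau] := DRNI_objective_le_feasible wF.
split=> // u' du'.
have [z' [D' [t' [e' [wF' ->]]]]] := DRNI_completion zb0 du'.
exact: le_trans le_tau (wmin _ wF').
Qed.

End CVaR_reformulation.

(** * Bi-convexity of the reformulation *)

Lemma conv_ge0 (R : numDomainType) (p : {i01 R}) (x y : R) :
  0 <= x -> 0 <= y -> 0 <= p%:num * x + (1 - p%:num) * y.
Proof.
by move=> x0 y0; rewrite addr_ge0 // mulr_ge0 // subr_ge0; exact: le1.
Qed.

Lemma conv_ler (R : numDomainType) (p : {i01 R}) (x y x' y' : R) :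
  x <= x' -> y <= y' ->
  p%:num * x + (1 - p%:num) * y <= p%:num * x' + (1 - p%:num) * y'.
Proof.
move=> xx' yy'; rewrite -subr_ge0.
have -> : p%:num * x' + (1 - p%:num) * y' - (p%:num * x + (1 - p%:num) * y) =
  p%:num * (x' - x) + (1 - p%:num) * (y' - y) by ring.
by apply: conv_ge0; rewrite subr_ge0.
Qed.

Lemma conv_ffunE (R : realType) (X : finType) (p : {i01 R})
    (g h : {ffun X -> R^o}) x :
  (p%:num *: g + (1 - p%:num) *: h) x = p%:num * g x + (1 - p%:num) * h x.
Proof. by rewrite !ffunE. Qed.

(* The only nonlinear constraint [eta l = u l * zeta] is preserved as soon as
   one of the two factors is the same at both points. *)
Lemma reformulation_constraints_conv (R : realType) (L K : finType)
    (Q : set {ffun K -> R^o}) (alpha : R) (f : L -> K -> R) (zetabar : R)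
    (p : {i01 R}) (u u' : {ffun L -> R^o}) (zeta zeta' : R)
    (Delta Delta' : {ffun L * K -> R^o}) (tau tau' : R)
    (eta eta' : {ffun L -> R^o}) :
  u = u' \/ zeta = zeta' ->
  reformulation_constraints Q alpha f zetabar u zeta Delta tau eta ->
  reformulation_constraints Q alpha f zetabar u' zeta' Delta' tau' eta' ->
  reformulation_constraints Q alpha f zetabar
    (p%:num *: u + (1 - p%:num) *: u')
    (p%:num * zeta + (1 - p%:num) * zeta')
    (p%:num *: Delta + (1 - p%:num) *: Delta')
    (p%:num * tau + (1 - p%:num) * tau')
    (p%:num *: eta + (1 - p%:num) *: eta').
Proof.
move=> same [Htau HD Heta D0 [u0 u1 /andP[z0 zb]]].
move=> [Htau' HD' Heta' D0' [u0' u1' /andP[z0' zb']]].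
split.
- move=> q Qq; apply: le_trans (conv_ler p (Htau q Qq) (Htau' q Qq)).
  rewrite le_eqVlt; apply/orP; left; apply/eqP.
  have -> : \sum_(l : L) \sum_(k : K)
        q k * (p%:num *: Delta + (1 - p%:num) *: Delta') (l, k) =
      p%:num * (\sum_(l : L) \sum_(k : K) q k * Delta (l, k)) +
      (1 - p%:num) * (\sum_(l : L) \sum_(k : K) q k * Delta' (l, k)).
    rewrite -sum2_conv; apply: eq_bigr => l _; apply: eq_bigr => k _.
    by rewrite conv_ffunE; ring.
  by ring.
- move=> l k; rewrite !conv_ffunE.
  apply: le_trans (conv_ler p (HD l k) (HD' l k)).
  by rewrite le_eqVlt; apply/orP; left; apply/eqP; ring.
- by move=> l; rewrite !conv_ffunE Heta Heta'; case: same => ->; ring.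
- by move=> l k; rewrite conv_ffunE; exact: conv_ge0.
- split.
  + by move=> l; rewrite conv_ffunE; exact: conv_ge0.
  + under eq_bigr do rewrite conv_ffunE.
    by rewrite big_split /= -!mulr_sumr u1 u1' !mulr1 subrKC.
  + rewrite conv_ge0 //=.
    have -> : zetabar = p%:num * zetabar + (1 - p%:num) * zetabar by ring.
    exact: conv_ler.
Qed.

Lemma reformulation_biconvex (R : realType) (L K : finType)
    (Q : set {ffun K -> R^o}) (alpha : R) (f : L -> K -> R) (zetabar : R) :
  biconvex_reformulation Q alpha f zetabar.
Proof.
split=> [zeta|u]; split.
- move=> [[[u D] t] e] [[[u' D'] t'] e'] p /set_mem wF /set_mem wF'.
  apply: mem_set.
  have := reformulation_constraints_conv p (or_intror erefl) wF wF'.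
  (* The fixed [zeta] appears as a convex combination of itself and collapses. *)
  by rewrite -mulrDl subrKC mul1r.
- by move=> p [[[u D] t] e] [[[u' D'] t'] e'] _ _; exact: lexx.
- move=> [[[z D] t] e] [[[z' D'] t'] e'] p /set_mem wF /set_mem wF'.
  apply: mem_set.
  have := reformulation_constraints_conv p (or_introl erefl) wF wF'.
  by rewrite -scalerDl subrKC scale1r.
- by move=> p [[[z D] t] e] [[[z' D'] t'] e'] _ _; exact: lexx.
Qed.

(** * Specialization to interdicted maximum flows *)

Theorem proposition1 (R : realType) (V E : finType) (tail head : E -> V)
  (s t : V) (hst : s != t)
  (K : finType) (hK : (0 < #|K|)%N)
  (c : K -> E -> R) (hc : forall k e, 0 <= c k e)
  (B : nat)
  (Q : set {ffun K -> R^o}) (hQ : Q `<=` distributions R K) (hQ0 : Q !=set0)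
  (hQc : convex_set (Q : set (convex_lmodType {ffun K -> R^o})))
  (alpha : R) (halpha : 0 <= alpha < 1) :
  let L : finType := plan E B in
  let f : L -> K -> R := interdicted_flow tail head s t c (B := B) in
  let zetabar : R := sup (range (fun k => f (plan0 E B) k)) in
  let obj1 := DRNI_objective Q alpha f in
  let feas2 := reformulation_feasible Q alpha f zetabar in
  let obj2 := @reformulation_objective R L K in
  [/\ optimal_value (distributions R L) obj1 = optimal_value feas2 obj2,
      forall u : {ffun L -> R^o},
        optimal_solution (distributions R L) obj1 u <->
        exists (zeta : R) (Delta : {ffun L * K -> R^o}) (tau : R)
               (eta : {ffun L -> R^o}),
          optimal_solution feas2 obj2 (u, zeta, Delta, tau, eta) &
      biconvex_reformulation Q alpha f zetabar].
Proof.
move=> L f zetabar obj1 feas2 obj2.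
have f0 l k : 0 <= f l k by exact: interdicted_flow_ge0.
have fzb l k : f l k <= zetabar.
  apply: le_trans (interdicted_flow_le_plan0 _ _ _ _ _ _ hc) _.
  exact: (le_sup_range (fun k => f (plan0 E B) k)).
have zb0 : 0 <= zetabar.
  by have /card_gt0P[k _] := hK; exact: le_trans (f0 (plan0 E B) k) (fzb _ k).
split.
- exact: DRNI_optimal_value.
- by move=> u; exact: DRNI_optimal_solution.
- exact: reformulation_biconvex.
Qed.
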